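(* Let $\mathbf m,\mathbf n$ be positive integers with $m=\mathbf m^2$ dividing $n=\mathbf n^2$, and $G=\mathbb Z_m\times\mathbb Z_n=\langle g_1\rangle\times\langle g_2\rangle$. Let $V=kX_1\oplus kX_2\in{}^G_G\mathcal{YD}$ be a direct sum of one-dimensional Yetter–Drinfeld modules with finite-dimensional Nichols algebra, with coaction $X_i\mapsto h_i\otimes X_i$ and action $h_i\diamond X_j=q_{ij}X_j$, where $h_1,h_2$ generate $G$. Write $h_1=g_1^{\alpha_1}g_2^{\alpha_2}$, $h_2=g_1^{\beta_1}g_2^{\beta_2}$, $g_1=h_1^{s_1}h_2^{s_2}$, $g_2=h_1^{t_1}h_2^{t_2}$ with $\alpha_i,\beta_i,s_i,t_i\in\mathbb N$, and $g_1\diamond X_j=\zeta_m^{x_{1j}}X_j$, $g_2\diamond X_j=\zeta_n^{x_{2j}}X_j$ with $0\le x_{1j}<m$, $0\le x_{2j}<n$ $(j=1,2)$. Then the system of equations $$\zeta_m^{a\alpha_1\mathbf m}\zeta_{\mathbf m\mathbf n}^{b\alpha_2\mathbf m}=q_{11}^{\mathbf ms_1}q_{21}^{\mathbf ms_2},\quad \zeta_m^{a\beta_1\mathbf m}\zeta_{\mathbf m\mathbf n}^{b\beta_2\mathbf m}=q_{12}^{\mathbf ms_1}q_{22}^{\mathbf ms_2},\quad \zeta_n^{d\alpha_2\mathbf n}=q_{11}^{\mathbf nt_1}q_{21}^{\mathbf nt_2},\quad \zeta_n^{d\beta_2\mathbf n}=q_{12}^{\mathbf nt_1}q_{22}^{\mathbf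 nt_2}$$ in integers $0\le a,b<\mathbf m$, $0\le d<\mathbf n$ has at most one solution, and a solution, if it exists, is of the form $$a=(x_{11}s_1+x_{12}s_2)',\qquad b=\Big(\frac{\mathbf n}{\mathbf m}(x_{11}t_1+x_{12}t_2)\Big)',\qquad d=(t_1x_{21}+t_2x_{22})'',$$ where $x'$ and $x''$ denote the remainders of $x$ modulo $\mathbf m$ and modulo $\mathbf n$ respectively.
   Context: $k$ is an algebraically closed field of characteristic $0$. ${}^G_G\mathcal{YD}$ is the category of (left-left) Yetter–Drinfeld modules over $kG$. Primitive $N$-th roots of unity $\zeta_N\in k$ are chosen with $\zeta_m^{\mathbf m}=\zeta_{\mathbf m\mathbf n}^{\mathbf n}=\zeta_{\mathbf m}$ and $\zeta_n^{\mathbf n}=\zeta_{\mathbf m\mathbf n}^{\mathbf m}=\zeta_{\mathbf n}$ (e.g. $\zeta_N=e^{2\pi i/N}$). *)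

(* Defs.v *)
From HB Require Import structures.
From mathcomp Require Import all_boot all_order all_algebra all_fingroup.
From mathcomp Require Import finmap monalg.

Set Implicit Arguments.
Unset Strict Implicit.
Unset Printing Implicit Defensive.

Import GRing.Theory.
Local Open Scope ring_scope.

(* A finite-dimensional left-left Yetter-Drinfeld module over the group algebra
   k[gT].  As gT is a basis of k[gT], a linear map delta : V -> k[gT] (x) V is a
   family of endomorphisms, delta(v) = \sum_g g (x) yd_coact g v. *)
Record ydModule (k : fieldType) (gT : finGroupType) := YDModule {
  yd_space :> vectType k;
  yd_act : gT -> 'End(yd_space);
  yd_coact : gT -> 'End(yd_space);
  yd_act1 : yd_act 1%g = \1%VF;
  yd_actM : forall g h, yd_act (g * h)%g = (yd_act g \o yd_act h)%VF;
  yd_counit : \sum_g yd_coact g = \1%VF;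
  yd_coassoc : forall g h,
    (yd_coact g \o yd_coact h)%VF = if g == h then yd_coact h else 0;
  yd_compat : forall g h,
    (yd_coact (g * h * g^-1)%g \o yd_act g)%VF = (yd_act g \o yd_coact h)%VF
}.

(* Linear extension to the free module on K of a function on K. *)
Definition linext (K : choiceType) (R : nzRingType) (M : lmodType R)
  (f : K -> M) (t : {malg R[K]}) : M := \sum_(w <- msupp t) t@_w *: f w.

Section YetterDrinfeld.
Variables (k : fieldType) (gT : finGroupType) (V : ydModule k gT).

Definition yd_submodule (U : {vspace V}) : Prop :=
  forall g, (yd_act V g @: U <= U)%VS /\ (yd_coact V g @: U <= U)%VS.

(* delta(v) = h (x) v *)
Definition yd_coacts_by (h : gT) (v : V) : Prop :=
  forall g, yd_coact V g v = if g == h then v else 0.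

(* The tensor algebra T(V) is the free algebra on a basis of V, and
   T(V) (x) T(V) is the free module on pairs of words. *)
Local Notation letter := 'I_(\dim {:V}).
Local Notation word := {fmonom letter}.
Local Notation tensor_alg := {malg k[word]}.
Local Notation tensor_alg2 := {malg k[(word * word)%type]}.

Implicit Types (g h : gT) (s : seq letter) (t : tensor_alg).

Definition letter_vec (i : letter) : V := (vbasis {:V})`_i.

Definition tincl (v : V) : tensor_alg :=
  \sum_i coord (vbasis {:V}) i v *: (<< fmu i >> : tensor_alg).

(* Yetter-Drinfeld structure of T(V): diagonal action and codiagonal coaction;
   tcoact g is the component at g of the coaction. *)
Definition tact g : tensor_alg -> tensor_alg :=
  linext (fun w : word =>
    \prod_(i <- (w : seq _)) tincl (yd_act V g (letter_vec i)) : tensor_alg).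

Fixpoint tcoact_word s g : tensor_alg :=
  if s is i :: s' then
    \sum_h tincl (yd_coact V h (letter_vec i)) * tcoact_word s' (h^-1 * g)%g
  else (g == 1%g)%:R.

Definition tcoact g : tensor_alg -> tensor_alg :=
  linext (fun w : word => tcoact_word w g).

Definition tens (a b : tensor_alg) : tensor_alg2 :=
  linext (fun u : word =>
    linext (fun v : word =>
      (<< (u, v) >> : tensor_alg2)) b) a.

(* (a (x) b)(c (x) d) = a (b_(-1) . c) (x) b_(0) d *)
Definition braided_mul (x y : tensor_alg2) : tensor_alg2 :=
  linext (fun p : (word * word)%type =>
    linext (fun q : (word * word)%type =>
      \sum_h tens (<< p.1 >> * tact h << q.1 >>)
                  (tcoact h << p.2 >> * << q.2 >>)) y) x.

(* The algebra morphism with Delta(v) = v (x) 1 + 1 (x) v on V. *)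
Definition comul : tensor_alg -> tensor_alg2 :=
  linext (fun w : word =>
    foldr (fun i => braided_mul (tens << fmu i >> 1 + tens 1 << fmu i >>))
      (tens 1 1) (w : seq _)).

Definition counit t : k := t@_(FMonom [::]).

(* S(v) = - v on V and S(x y) = S(x_(-1) . y) S(x_(0)) = (x_(-1) . S y) S(x_(0)) *)
Definition antipode : tensor_alg -> tensor_alg :=
  linext (fun w : word =>
    foldr (fun i x =>
        - \sum_h tact h x * tincl (yd_coact V h (letter_vec i)))
      1 (w : seq _)).

Definition homog_part (n : nat) t : tensor_alg :=
  \sum_(w <- msupp t | fdeg w == n) t@_w *: (<< w >> : tensor_alg).

(* J (x) T(V) + T(V) (x) J *)
Definition coideal_span (J : tensor_alg -> Prop) (z : tensor_alg2) : Prop :=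
  exists r : seq (tensor_alg * tensor_alg),
    (forall p, p \in r -> J p.1 \/ J p.2) /\ z = \sum_(p <- r) tens p.1 p.2.

(* Graded Hopf ideals of the braided Hopf algebra T(V). *)
Record graded_hopf_ideal (J : tensor_alg -> Prop) : Prop := GradedHopfIdeal {
  ghi_0 : J 0;
  ghi_add : forall x y, J x -> J y -> J (x + y);
  ghi_mull : forall a x, J x -> J (a * x);
  ghi_mulr : forall a x, J x -> J (x * a);
  ghi_act : forall g x, J x -> J (tact g x);
  ghi_coact : forall g x, J x -> J (tcoact g x);
  ghi_comul : forall x, J x -> coideal_span J (comul x);
  ghi_counit : forall x, J x -> counit x = 0;
  ghi_antipode : forall x, J x -> J (antipode x);
  ghi_graded : forall n x, J x -> J (homog_part n x)
}.

(* Being graded, J is generated by homogeneous elements of degree at least 2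
   when it lies in the sum of the components of degree at least 2. *)
Definition nichols_candidate (J : tensor_alg -> Prop) : Prop :=
  graded_hopf_ideal J /\
  forall x w, J x -> w \in msupp x -> (2 <= fdeg w)%N.

(* The largest such ideal; the Nichols algebra is B(V) = T(V) / I(V). *)
Definition nichols_ideal (J : tensor_alg -> Prop) : Prop :=
  nichols_candidate J /\
  forall J', nichols_candidate J' -> forall x, J' x -> J x.

Definition nichols_findim : Prop :=
  exists2 J, nichols_ideal J &
  exists (d : nat) (e : 'I_d -> tensor_alg),
    forall x, exists c : 'I_d -> k, J (x - \sum_i c i *: e i).

End YetterDrinfeld.

(* Main.v *)
(* Since [h1 ^+ s1 * h2 ^+ s2 = g1] and [h1 ^+ t1 * h2 ^+ t2 = g2], the right-hand
   sides of the system are the values of [g1 ^+ mm] and [g2 ^+ nn] on [X1] and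
   [X2], so in terms of zeta_mm and zeta_nn the system reads
     zeta_mm^(a alpha1) zeta_nn^(b alpha2) = zeta_mm^x11,
     zeta_mm^(a beta1) zeta_nn^(b beta2) = zeta_mm^x12,
     zeta_nn^(d alpha2) = zeta_nn^x21,  zeta_nn^(d beta2) = zeta_nn^x22.
   The base changes (alpha, beta) and (s, t) are mutually inverse modulo (m, n).
   Combining the first two equations with exponents (s1, s2) isolates a and with
   (t1, t2) isolates b, because zeta_mm = zeta_nn^(nn/mm); the last two with
   (t1, t2) isolate d. *)
Require Import Defs.
From mathcomp Require Import all_boot all_order all_algebra all_fingroup.
From mathcomp Require Import cyclic.

Set Implicit Arguments.
Unset Strict Implicit.
Unset Printing Implicit Defensive.

Import GRing.Theory.
Local Open Scope ring_scope.

Section ActionEigenvectors.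
Variables (k : fieldType) (gT : finGroupType) (V : ydModule k gT).
Implicit Types (g h : gT) (X : V) (c d : k).

Lemma yd_actM_eigen g h X c d :
  yd_act V g X = c *: X -> yd_act V h X = d *: X ->
  yd_act V (g * h)%g X = (c * d) *: X.
Proof.
by move=> gX hX; rewrite yd_actM comp_lfunE hX linearZ /= gX scalerA mulrC.
Qed.

Lemma yd_actX_eigen g X c e :
  yd_act V g X = c *: X -> yd_act V (g ^+ e)%g X = c ^+ e *: X.
Proof.
move=> gX; elim: e => [|e IHe]; first by rewrite expg0 yd_act1 id_lfunE scale1r.
by rewrite expgS exprS; apply: yd_actM_eigen.
Qed.

(** Turns a relation between group elements, such as [g1] being a word in [h1] and [h2], into one
    between eigenvalues; scalars can be compared because [X] is nonzero. *)
Lemma yd_act_word_eigen g h X c d i j e :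
  X != 0 -> yd_act V g X = c *: X -> yd_act V h X = d *: X ->
  yd_act V (g ^+ i * h ^+ j)%g X = e *: X -> c ^+ i * d ^+ j = e.
Proof.
move=> X0 gX hX.
rewrite (yd_actM_eigen (yd_actX_eigen i gX) (yd_actX_eigen j hX)).
move/eqP; rewrite -subr_eq0 -scalerBl scaler_eq0 (negPf X0) orbF.
by rewrite subr_eq0 => /eqP.
Qed.

End ActionEigenvectors.

(** Moving powers of [x] to one side and of [y] to the other puts their common value in the trivial
    intersection of the two factors. *)
Lemma dprod_cycle_expg_mod (gT : finGroupType) (G : {group gT}) (x y : gT)
    (i j i' j' : nat) :
  (<[x]> \x <[y]>)%g = G -> (x ^+ i * y ^+ j = x ^+ i' * y ^+ j')%g ->
  i = i' %[mod #[x]%g] /\ j = j' %[mod #[y]%g].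
Proof.
case/dprodP=> _ _ _ tixy eq_xy.
have xi : (x ^+ i \in <[x]>)%g by apply: mem_cycle.
have xi' : (x ^+ i' \in <[x]>)%g by apply: mem_cycle.
have yj : (y ^+ j \in <[y]>)%g by apply: mem_cycle.
have yj' : (y ^+ j' \in <[y]>)%g by apply: mem_cycle.
have eq_x : ((x ^+ i')^-1 * x ^+ i = y ^+ j' * (y ^+ j)^-1)%g.
  by apply: (canRL (mulgK _)); rewrite -mulgA eq_xy mulKg.
have : ((x ^+ i')^-1 * x ^+ i \in <[x]> :&: <[y]>)%g.
  by rewrite inE groupM ?groupV //= eq_x groupM ?groupV.
rewrite tixy => /set1gP x1.
have Ex : (x ^+ i = x ^+ i')%g by rewrite -[RHS]mulg1 -x1 mulKVg.
have Ey : (y ^+ j = y ^+ j')%g by apply: (mulgI (x ^+ i)%g); rewrite eq_xy Ex.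
by split; apply/eqP; rewrite -eq_expg_mod_order; apply/eqP.
Qed.

(** As [g1] and [g2] commute, exponents can be collected factor by factor. Applied to [g1] and [g2]
    as words in [h1], [h2], this says that the two exponent matrices are inverse to each other. *)
Lemma base_change_expg_mod (gT : finGroupType) (G : {group gT}) (g1 g2 : gT)
    (a1 a2 b1 b2 u1 u2 e1 e2 : nat) :
  (<[g1]> \x <[g2]>)%g = G ->
  (g1 ^+ e1 * g2 ^+ e2 =
   (g1 ^+ a1 * g2 ^+ a2) ^+ u1 * (g1 ^+ b1 * g2 ^+ b2) ^+ u2)%g ->
  a1 * u1 + b1 * u2 = e1 %[mod #[g1]%g] /\
  a2 * u1 + b2 * u2 = e2 %[mod #[g2]%g].
Proof.
move=> dG eqg; apply: (dprod_cycle_expg_mod dG); rewrite eqg.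
have c12 : commute g1 g2.
  case/dprodP: dG => _ _ /centsP cg _.
  by apply/commute_sym/cg; apply: cycle_id.
have cX i j : commute (g1 ^+ i)%g (g2 ^+ j)%g.
  by apply: commuteX; apply/commute_sym/commuteX/commute_sym.
rewrite !expgMn // -!expgM !expgD -!mulgA; congr (_ * _)%g.
by rewrite !mulgA; congr (_ * _)%g; apply: cX.
Qed.

Lemma modnMl_dvd (d N i j e : nat) :
  (d %| N)%N -> j = e %[mod N] -> i * j = i * e %[mod d].
Proof. by move=> dN je; rewrite -modnMmr -(modn_dvdm j dN) je modn_dvdm // modnMmr. Qed.

Lemma expr_mod_prim_root (R : nzRingType) (N : nat) (z : R) (i j : nat) :
  N.-primitive_root z -> (i = j %[mod N])%N -> z ^+ i = z ^+ j.
Proof. by move=> zP ij; apply/eqP; rewrite (eq_prim_root_expr zP) ij. Qed.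

Lemma expr_combine (R : comPzRingType) (y z : R) (a b a1 a2 b1 b2 u1 u2 : nat) :
  (y ^+ (a * a1) * z ^+ (b * a2)) ^+ u1 * (y ^+ (a * b1) * z ^+ (b * b2)) ^+ u2 =
  y ^+ (a * (a1 * u1 + b1 * u2)) * z ^+ (b * (a2 * u1 + b2 * u2)).
Proof.
by rewrite !exprMn -!exprM mulrACA -!exprD !mulnDr !mulnA.
Qed.

Theorem proposition5p8
  (k : closedFieldType) (k_char0 : [pchar k] =i pred0)
  (mm nn : nat) (mm_gt0 : (0 < mm)%N) (nn_gt0 : (0 < nn)%N)
  (m n : nat) (m_def : m = (mm ^ 2)%N) (n_def : n = (nn ^ 2)%N)
  (m_dvd_n : (m %| n)%N)
  (* the chosen roots of unity *)
  (zeta : nat -> k)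
  (zetaP : forall N, (0 < N)%N -> N.-primitive_root (zeta N))
  (zeta_m : zeta m ^+ mm = zeta mm)
  (zeta_mn_n : zeta (mm * nn)%N ^+ nn = zeta mm)
  (zeta_n : zeta n ^+ nn = zeta nn)
  (zeta_mn_m : zeta (mm * nn)%N ^+ mm = zeta nn)
  (* G = <g1> x <g2>, the whole of gT *)
  (gT : finGroupType) (g1 g2 : gT)
  (g1_order : #[g1]%g = m) (g2_order : #[g2]%g = n)
  (G_def : (<[g1]> \x <[g2]>)%g = [set: gT])
  (* V = k X1 (+) k X2 *)
  (V : ydModule k gT) (X1 X2 : V)
  (X_basis : basis_of fullv [:: X1; X2])
  (X1_yd : yd_submodule <[X1]>%VS) (X2_yd : yd_submodule <[X2]>%VS)
  (V_findim : nichols_findim V)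
  (h1 h2 : gT)
  (X1_coact : yd_coacts_by h1 X1) (X2_coact : yd_coacts_by h2 X2)
  (h_gen : <<[set h1; h2]>>%g = [set: gT])
  (q11 q12 q21 q22 : k)
  (q11_def : yd_act V h1 X1 = q11 *: X1) (q12_def : yd_act V h1 X2 = q12 *: X2)
  (q21_def : yd_act V h2 X1 = q21 *: X1) (q22_def : yd_act V h2 X2 = q22 *: X2)
  (alpha1 alpha2 beta1 beta2 s1 s2 t1 t2 : nat)
  (h1_def : h1 = (g1 ^+ alpha1 * g2 ^+ alpha2)%g)
  (h2_def : h2 = (g1 ^+ beta1 * g2 ^+ beta2)%g)
  (g1_def : g1 = (h1 ^+ s1 * h2 ^+ s2)%g)
  (g2_def : g2 = (h1 ^+ t1 * h2 ^+ t2)%g)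
  (x11 x12 x21 x22 : nat)
  (x11_lt : (x11 < m)%N) (x12_lt : (x12 < m)%N)
  (x21_lt : (x21 < n)%N) (x22_lt : (x22 < n)%N)
  (x11_def : yd_act V g1 X1 = zeta m ^+ x11 *: X1)
  (x12_def : yd_act V g1 X2 = zeta m ^+ x12 *: X2)
  (x21_def : yd_act V g2 X1 = zeta n ^+ x21 *: X1)
  (x22_def : yd_act V g2 X2 = zeta n ^+ x22 *: X2) :
  let solution (a b d : nat) : Prop :=
    [/\ (a < mm)%N, (b < mm)%N & (d < nn)%N] /\
    [/\ zeta m ^+ (a * alpha1 * mm) * zeta (mm * nn)%N ^+ (b * alpha2 * mm)
          = q11 ^+ (mm * s1) * q21 ^+ (mm * s2),
        zeta m ^+ (a * beta1 * mm) * zeta (mm * nn)%N ^+ (b * beta2 * mm)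
          = q12 ^+ (mm * s1) * q22 ^+ (mm * s2),
        zeta n ^+ (d * alpha2 * nn) = q11 ^+ (nn * t1) * q21 ^+ (nn * t2) &
        zeta n ^+ (d * beta2 * nn) = q12 ^+ (nn * t1) * q22 ^+ (nn * t2)] in
  (forall a b d a' b' d' : nat,
     solution a b d -> solution a' b' d' -> (a, b, d) = (a', b', d')) /\
  (forall a b d : nat, solution a b d ->
     [/\ a = (x11 * s1 + x12 * s2) %% mm,
         b = (nn %/ mm * (x11 * t1 + x12 * t2)) %% mm &
         d = (t1 * x21 + t2 * x22) %% nn]%N).
Proof.
have freeX := basis_free X_basis.
have X10 : X1 != 0 by apply: (free_not0 freeX); rewrite inE eqxx.
have X20 : X2 != 0 by apply: (free_not0 freeX); rewrite !inE eqxx orbT.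
have [As Bs] : alpha1 * s1 + beta1 * s2 = 1 %[mod m] /\
               alpha2 * s1 + beta2 * s2 = 0 %[mod n].
  rewrite -g1_order -g2_order; apply: (base_change_expg_mod G_def).
  by rewrite mulg1 -h1_def -h2_def.
have [At Bt] : alpha1 * t1 + beta1 * t2 = 0 %[mod m] /\
               alpha2 * t1 + beta2 * t2 = 1 %[mod n].
  rewrite -g1_order -g2_order; apply: (base_change_expg_mod G_def).
  by rewrite mul1g -h1_def -h2_def.
have mm_m : (mm %| m)%N by rewrite m_def dvdn_exp.
have nn_n : (nn %| n)%N by rewrite n_def dvdn_exp.
have mm_nn : (mm %| nn)%N by move: m_dvd_n; rewrite m_def n_def dvdn_pexp2r.
(* Only powers of [zeta mm] and [zeta nn] will remain, so the congruences are weakened to the moduli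
   [mm] and [nn]. *)
have {}As i : i * (alpha1 * s1 + beta1 * s2) = i %[mod mm].
  by rewrite (modnMl_dvd i mm_m As) muln1.
have {}At i : i * (alpha1 * t1 + beta1 * t2) = 0 %[mod mm].
  by rewrite (modnMl_dvd i mm_m At) muln0.
have {}Bs i : i * (alpha2 * s1 + beta2 * s2) = 0 %[mod nn].
  by rewrite (modnMl_dvd i nn_n Bs) muln0.
have {}Bt i : i * (alpha2 * t1 + beta2 * t2) = i %[mod nn].
  by rewrite (modnMl_dvd i nn_n Bt) muln1.
have zmP := zetaP mm mm_gt0; have znP := zetaP nn nn_gt0.
have zmn : zeta mm = zeta nn ^+ (nn %/ mm).
  by rewrite -zeta_mn_m -exprM (mulnC mm (nn %/ mm)%N) divnK.
have E11 : q11 ^+ s1 * q21 ^+ s2 = zeta m ^+ x11.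
  by apply: (yd_act_word_eigen X10 q11_def q21_def); rewrite -g1_def.
have E12 : q12 ^+ s1 * q22 ^+ s2 = zeta m ^+ x12.
  by apply: (yd_act_word_eigen X20 q12_def q22_def); rewrite -g1_def.
have E21 : q11 ^+ t1 * q21 ^+ t2 = zeta n ^+ x21.
  by apply: (yd_act_word_eigen X10 q11_def q21_def); rewrite -g2_def.
have E22 : q12 ^+ t1 * q22 ^+ t2 = zeta n ^+ x22.
  by apply: (yd_act_word_eigen X20 q12_def q22_def); rewrite -g2_def.
have pull (x y z : k) N i j e : x ^+ i * y ^+ j = z ^+ e ->
    x ^+ (N * i) * y ^+ (N * j) = (z ^+ N) ^+ e.
  by move=> xy; rewrite !(mulnC N) !exprM -exprMn xy exprAC.
have pushm i : zeta m ^+ (i * mm) = zeta mm ^+ i by rewrite (mulnC i) exprM zeta_m.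
have pushn i : zeta n ^+ (i * nn) = zeta nn ^+ i by rewrite (mulnC i) exprM zeta_n.
have pushmn i : zeta (mm * nn)%N ^+ (i * mm) = zeta nn ^+ i.
  by rewrite (mulnC i) exprM zeta_mn_m.
move=> solution.
have solE a b d : solution a b d ->
    [/\ a = (x11 * s1 + x12 * s2) %% mm,
        b = (nn %/ mm * (x11 * t1 + x12 * t2)) %% mm &
        d = (t1 * x21 + t2 * x22) %% nn]%N.
  case=> [[lta ltb ltd] []].
  rewrite !pushm !pushmn !pushn (pull _ _ _ _ _ _ _ E11) (pull _ _ _ _ _ _ _ E12).
  rewrite (pull _ _ _ _ _ _ _ E21) (pull _ _ _ _ _ _ _ E22) zeta_m zeta_n.
  move=> e1 e2 e3 e4.
  have comb u1 u2 : zeta mm ^+ (a * (alpha1 * u1 + beta1 * u2)) *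
      zeta nn ^+ (b * (alpha2 * u1 + beta2 * u2)) =
      zeta mm ^+ (x11 * u1 + x12 * u2).
    by rewrite -expr_combine e1 e2 -!exprM -exprD.
  (* The last two equations involve only the [g2]-exponents of [h1] and [h2], so a single
     congruence, [Bt], will isolate [d]. *)
  have comb' : zeta nn ^+ (d * (alpha2 * t1 + beta2 * t2)) =
      zeta nn ^+ (t1 * x21 + t2 * x22).
    rewrite mulnDr !mulnA exprD (exprM _ _ t1) (exprM _ _ t2) e3 e4 -!exprM.
    by rewrite -exprD !(mulnC t1, mulnC t2).
  split.
  - have := comb s1 s2.
    rewrite (expr_mod_prim_root zmP (As a)) (expr_mod_prim_root znP (Bs b)) mulr1.
    by move/eqP; rewrite (eq_prim_root_expr zmP) => /eqP <-; rewrite modn_small.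
  - have := comb t1 t2.
    rewrite (expr_mod_prim_root zmP (At a)) (expr_mod_prim_root znP (Bt b)) mul1r.
    (* In powers of [zeta nn] the equation determines [b] modulo [nn]; since [mm] divides [nn] and
       [b < mm], reducing modulo [mm] recovers [b] itself. *)
    rewrite zmn -exprM => /eqP; rewrite (eq_prim_root_expr znP) => /eqP eqb.
    by rewrite -(modn_dvdm _ mm_nn) -eqb modn_dvdm // modn_small.
  - move: comb'; rewrite (expr_mod_prim_root znP (Bt d)).
    by move/eqP; rewrite (eq_prim_root_expr znP) => /eqP <-; rewrite modn_small.
(* Uniqueness follows because the formulas depend only on the given data. *)
by split=> // a b d a' b' d' /solE [-> -> ->] /solE [-> -> ->].
Qed.
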